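(* Let $\mathbb{F}$ be a division ring, $\sigma:\mathbb{F}\to\mathbb{F}$ a ring endomorphism, $\delta:\mathbb{F}\to\mathbb{F}$ a $\sigma$-derivation, and $\mathcal{R}=\mathbb{F}[x;\sigma,\delta]$. For $k\ge 0$ let $\mathcal{P}_k(\mathbb{F})$ be the set of polynomials in $\mathcal{R}$ of degree less than or equal to $k$. Let $f,g\in\mathcal{R}$ be two polynomials of positive degree $m,n$, respectively. Consider the left $\mathbb{F}$-linear map $$\varphi:\mathcal{P}_{n-1}(\mathbb{F})\oplus\mathcal{P}_{m-1}(\mathbb{F})\to\mathcal{P}_{n+m-1}(\mathbb{F}),\qquad \varphi((a,b)):=af+bg.$$ Then $$\deg \mathrm{gcrd}(f,g)=\dim\ker\varphi=\dim\ker\phi=n+m-lr.rk(A)=n+m-rc.rk(A),$$ where $A:=\mathrm{Sylv}^{\sigma,\delta}_{\mathbb{F}}(f,g)$, $\phi:\mathbb{F}^{n+m}\to\mathbb{F}^{n+m}$ is the left $\mathbb{F}$-linear map $\phi(\vec{x}):=\vec{x}A$ (row vectors), $lr.rk(A)$ is the dimension of the left $\mathbb{F}$-subspace spanned by the rows of $A$ in the left vector space $\mathbb{F}^{n+m}$, and $rc.rk(A)$ is the dimension of the right $\mathbb{F}$-subspace spanned by the columns of $A$ in the right vector space $\mathbb{F}^{n+m}$.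
   Context: A $\sigma$-derivation is an additive map $\delta:\mathbb{F}\to\mathbb{F}$ with $\delta(ab)=\sigma(a)\delta(b)+\delta(a)b$ for all $a,b\in\mathbb{F}$ ($\sigma$ a non-zero ring endomorphism). The skew polynomial ring $\mathcal{R}=\mathbb{F}[x;\sigma,\delta]$ is the set of polynomials $\sum_i a_ix^i$ ($a_i\in\mathbb{F}$) with usual addition and multiplication determined by $xa=\sigma(a)x+\delta(a)$ for $a\in\mathbb{F}$. Every left ideal of $\mathcal{R}$ is principal; $\mathrm{gcrd}(f,g)$ (greatest common right divisor) is the monic generator of $\mathcal{R}f+\mathcal{R}g$. Dimensions of kernels are as left $\mathbb{F}$-vector spaces. Right $(\sigma,\delta)$-Sylvester matrix: for $f=\sum_{i=0}^m a_ix^i$ and $g=\sum_{j=0}^n b_jx^j$ of degrees $m,n$, $\mathrm{Sylv}^{\sigma,\delta}_{\mathbb{F}}(f,g)$ is the $(m+n)\times(m+n)$ matrix over $\mathbb{F}$ whose rows are, in order, the vectors of left coefficients with respect to $1,x,\dots,x^{m+n-1}$ of $f,xf,\dots,x^{n-1}f,g,xg,\dots,x^{m-1}g$. Explicitly, the coefficient of $x^q$ in $x^pf$ is $\sum_{l=0}^{p}\mathcal{C}_{p-l,l}(a_{q-l})$ (with $a_j=0$ for $j\notin\{0,\dots,m\}$), where $\mathcal{C}_{d,s}(a)$ is the sum of all possible compositions of $d$ copies of $\delta$ and $s$ copies of $\sigma$ evaluated at $a$, and $\mathcal{C}_{0,0}(a)=a$; similarly for $g$. *)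

(* Defs.v *)
From HB Require Import structures.
From mathcomp Require Import all_boot all_order all_algebra.
From mathcomp Require Import boolp classical_sets.

Set Implicit Arguments.
Unset Strict Implicit.
Unset Printing Implicit Defensive.

Import GRing.Theory.
Local Open Scope ring_scope.

Definition division_ring (F : unitRingType) : Prop :=
  forall a : F, a != 0 -> a \is a GRing.unit.

Section LeftDimension.
Variables (R : nzRingType) (V : lmodType R).
Implicit Types (U : set V).

Definition lspan n (e : 'I_n -> V) : set V :=
  [set v | exists c : 'I_n -> R, v = \sum_i c i *: e i]%classic.

Definition lfree n (e : 'I_n -> V) : Prop :=
  forall c : 'I_n -> R, \sum_i c i *: e i = 0 -> forall i, c i = 0.

Definition is_ldim U (n : nat) : Prop :=
  exists e : 'I_n -> V, lfree e /\ lspan e = U.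

(* The number of elements of a basis of U; 0 if U has no finite basis. *)
Definition ldim U : nat := xget 0%N [set n | is_ldim U n]%classic.

End LeftDimension.

Lemma division_dep (R : unitRingType) (divR : division_ring R) m n
    (C : 'I_m -> 'I_n -> R) : (n < m)%N ->
  exists2 x : 'I_m -> R, exists i, x i != 0 &
    forall j, \sum_i x i * C i j = 0.
Proof.
elim: n m C => [|n IHn] m C ltnm.
  exists (fun=> 1); last by case.
  by exists (Ordinal ltnm); exact: oner_neq0.
case: m => // m in C ltnm *.
have [[k Ck]|C0] := pselect (exists k, C k ord0 != 0); last first.
  have [x [i xi] xC] := IHn _ (fun i j => C i (lift ord0 j)) (ltnW ltnm).
  exists x; first by exists i.
  move=> j; case: (unliftP ord0 j) => [j' ->|->]; first exact: xC.
  rewrite big1 // => i' _; have [->|Ci] := eqVneq (C i' ord0) 0.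
    by rewrite mulr0.
  by case: C0; exists i'.
have uCk := divR _ Ck; pose y i := C (lift k i) ord0 * (C k ord0)^-1.
have [x [i xi] xC] := IHn m
  (fun i j => C (lift k i) (lift ord0 j) - y i * C k (lift ord0 j)) ltnm.
pose z i := if unlift k i is Some i' then x i' else - \sum_i' x i' * y i'.
have zk : z k = - \sum_i' x i' * y i' by rewrite /z unlift_none.
have zl i' : z (lift k i') = x i' by rewrite /z liftK.
exists z; first by exists (lift k i); rewrite zl.
move=> j; rewrite (bigD1_ord k) //= zk.
under eq_bigr do rewrite zl.
rewrite mulNr mulr_suml -sumrN -big_split /=.
case: (unliftP ord0 j) => [j' ->|->].
  rewrite -[RHS](xC j'); apply: eq_bigr => i' _.
  by rewrite mulrBr !mulrA addrC.
by rewrite big1 // => i' _; rewrite /y -!mulrA mulVr // mulr1 addNr.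
Qed.

Lemma ldimE (R : unitRingType) (divR : division_ring R) (V : lmodType R)
  (U : set V) n : is_ldim U n -> ldim U = n.
Proof.
have le m k : is_ldim U m -> is_ldim U k -> (m <= k)%N.
  move=> [e [efree eU]] [b [_ bU]]; rewrite leqNgt; apply/negP => ltkm.
  have eb i : exists c : 'I_k -> R, e i = \sum_j c j *: b j.
    suff: lspan b (e i) by [].
    rewrite bU -eU; exists (fun i' => (i' == i)%:R).
    rewrite (bigD1 i) //= eqxx scale1r big1 ?addr0 // => i' /negbTE ->.
    by rewrite scale0r.
  have [C eC] := choice eb.
  have [x [i /eqP xi] xC] := division_dep divR C ltkm.
  apply: xi; apply: efree.
  under eq_bigr do rewrite eC scaler_sumr.
  rewrite exchange_big big1 //= => j _.
  under eq_bigr do rewrite scalerA.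
  by rewrite -scaler_suml xC scale0r.
move=> dimU; have /xgetPex : exists k, [set k | is_ldim U k]%classic k by exists n.
by move=> /(_ 0%N) dimU'; apply/eqP; rewrite eqn_leq !le.
Qed.

Definition lkernel (R : nzRingType) (U V : lmodType R) (h : {linear U -> V}) :
  set U := [set u | h u = 0]%classic.

Definition lr_rk (R : nzRingType) m n (A : 'M[R]_(m, n)) : nat :=
  ldim (lspan (fun i => row i A)).

(* A right R-vector space is a left vector space over the converse ring R^c:
   entrywise, scaling by a : R^c in 'cV[R^c]_m is v i 0 |-> v i 0 * a. *)
Definition rc_rk (R : nzRingType) m n (A : 'M[R]_(m, n)) : nat :=
  ldim (@lspan R^c 'cV[R^c]_m n (fun j => col j (A : 'M[R^c]_(m, n)))).

Fact rc_rk_scaleE (R : nzRingType) m (a : R) (v : 'cV[R]_m) i :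
  ((a : R^c) *: (v : 'cV[R^c]_m)) i 0 = v i 0 * a :> R.
Proof. by rewrite mxE. Qed.

Record sderivation (F : nzRingType) (sigma : {rmorphism F -> F}) := SDerivation {
  sder :> {additive F -> F};
  sderM : forall a b : F, sder (a * b) = sigma a * sder b + sder a * b }.

(* The carrier of F[x; sigma, delta] is {poly F}, with its left F-module
   structure; only the multiplication differs from that of {poly F}. *)
Definition skewpoly (F : nzRingType) (sigma : {rmorphism F -> F})
  (delta : sderivation sigma) : Type := {poly F}.

Section SkewPoly.
Variables (F : nzRingType) (sigma : {rmorphism F -> F}).
Variable delta : sderivation sigma.
Implicit Types (p q r : {poly F}) (a : F).

HB.instance Definition _ := GRing.Lmodule.on (skewpoly delta).

(* x * sum_i a_i x^i = sum_i (sigma a_i x^(i+1) + delta a_i x^i) *)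
Definition skew_Xmul p : {poly F} :=
  map_poly sigma p * 'X + map_poly delta p.

Definition skew_mul p q : {poly F} :=
  \sum_(i < size p) p`_i *: iter i skew_Xmul q.

Lemma skew_XmulD p q : skew_Xmul (p + q) = skew_Xmul p + skew_Xmul q.
Proof. by rewrite /skew_Xmul !raddfD mulrDl addrACA. Qed.

Lemma skew_Xmul0 : skew_Xmul 0 = 0.
Proof. by rewrite /skew_Xmul !raddf0 mul0r addr0. Qed.

Lemma sder1 : delta 1 = 0.
Proof.
have := sderM delta 1 1; rewrite rmorph1 mulr1 !mul1r mulr1 => /eqP.
by rewrite -subr_eq0 opprD addrA subrr sub0r oppr_eq0 => /eqP.
Qed.

Lemma skew_XmulZ a p :
  skew_Xmul (a *: p) = sigma a *: skew_Xmul p + delta a *: p.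
Proof.
apply/polyP=> i; rewrite /skew_Xmul !(coefD, coefZ, coefMX, coef_map_id0) ?raddf0 //.
rewrite sderM; case: i => [|i] /=; first by rewrite !add0r.
by rewrite rmorphM mulrDr addrA.
Qed.

Lemma skew_Xmul_sum (I : Type) (s : seq I) (P : pred I) (G : I -> {poly F}) :
  skew_Xmul (\sum_(i <- s | P i) G i) = \sum_(i <- s | P i) skew_Xmul (G i).
Proof. exact: (big_morph _ skew_XmulD skew_Xmul0). Qed.

Lemma skew_mulEw n p q : (size p <= n)%N ->
  skew_mul p q = \sum_(i < n) p`_i *: iter i skew_Xmul q.
Proof.
move=> len; rewrite /skew_mul (big_ord_widen n (fun i => p`_i *: iter i skew_Xmul q)) //.
rewrite big_mkcond; apply: eq_bigr => i _; case: ltnP => // lei.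
by rewrite nth_default ?scale0r.
Qed.

Lemma skew_mulDl : left_distributive skew_mul +%R.
Proof.
move=> p q r; pose n := maxn (size p) (size q).
rewrite (@skew_mulEw n (p + q)) ?size_polyD // (@skew_mulEw n p) ?leq_maxl //.
rewrite (@skew_mulEw n q) ?leq_maxr // -big_split /=.
by apply: eq_bigr => i _; rewrite coefD scalerDl.
Qed.

Lemma iter_skew_XmulD i p q :
  iter i skew_Xmul (p + q) = iter i skew_Xmul p + iter i skew_Xmul q.
Proof. by elim: i => //= i ->; rewrite skew_XmulD. Qed.

Lemma skew_mulDr : right_distributive skew_mul +%R.
Proof.
move=> p q r; rewrite /skew_mul -big_split /=.
by apply: eq_bigr => i _; rewrite iter_skew_XmulD scalerDr.
Qed.

Lemma skew_mulZl a p q : skew_mul (a *: p) q = a *: skew_mul p q.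
Proof.
rewrite (@skew_mulEw (size p)) ?size_scale_leq // scaler_sumr.
by apply: eq_bigr => i _; rewrite coefZ scalerA.
Qed.

Lemma skew_mul0l q : skew_mul 0 q = 0.
Proof. by rewrite /skew_mul size_poly0 big_ord0. Qed.

Lemma skew_mul_suml (I : Type) (s : seq I) (P : pred I) (G : I -> {poly F}) q :
  skew_mul (\sum_(i <- s | P i) G i) q = \sum_(i <- s | P i) skew_mul (G i) q.
Proof.
exact: (big_morph (skew_mul^~ q) (fun p r => skew_mulDl p r q) (skew_mul0l q)).
Qed.

Lemma skew_mulXn n q : skew_mul 'X^n q = iter n skew_Xmul q.
Proof.
rewrite /skew_mul size_polyXn big_ord_recr /= big1 => [|i _].
  by rewrite add0r coefXn eqxx scale1r.
by rewrite coefXn ltn_eqF ?scale0r.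
Qed.

Lemma skew_XmulXn n : skew_Xmul 'X^n = 'X^(n.+1).
Proof.
apply/polyP=> i; rewrite coefD coefMX !coef_map_id0 ?raddf0 // !coefXn.
have -> b : delta b%:R = 0 by rewrite raddfMn sder1 mul0rn.
rewrite addr0.
by case: i => [|i] //=; rewrite rmorph_nat.
Qed.

Lemma skew_XmulA p q : skew_mul (skew_Xmul p) q = skew_Xmul (skew_mul p q).
Proof.
rewrite -[p in LHS]coefK -[p in RHS]coefK !poly_def skew_Xmul_sum !skew_mul_suml skew_Xmul_sum.
apply: eq_bigr => i _; rewrite skew_XmulZ skew_mulDl !skew_mulZl skew_XmulXn.
by rewrite !skew_mulXn skew_XmulZ.
Qed.

Lemma skew_mulA : associative skew_mul.
Proof.
move=> p q r; rewrite [skew_mul p q]/skew_mul skew_mul_suml.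
apply: eq_bigr => i _; rewrite skew_mulZl; congr (_ *: _).
by elim: (i : nat) => //= k ->; rewrite skew_XmulA.
Qed.

Lemma skew_mul1l : left_id 1 skew_mul.
Proof. by move=> p; have := skew_mulXn 0 p; rewrite expr0. Qed.

Lemma skew_mul1r : right_id 1 skew_mul.
Proof.
move=> p; rewrite -[RHS]coefK poly_def; apply: eq_bigr => i _; congr (_ *: _).
by elim: (i : nat) => [|k /= ->]; rewrite ?expr0 // skew_XmulXn.
Qed.

HB.instance Definition _ := GRing.Zmodule_isNzRing.Build (skewpoly delta)
  skew_mulA skew_mul1l skew_mul1r skew_mulDl skew_mulDr (oner_neq0 {poly F}).

HB.instance Definition _ :=
  GRing.Lmodule_isLalgebra.Build F (skewpoly delta)
    (fun a p q => esym (skew_mulZl a p q)).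

Definition skewX : skewpoly delta := 'X.

Definition skewC a : skewpoly delta := a%:P.

(* The commutation rule and the normal form that determine the product. *)
Lemma skewXC a :
  skewX * skewC a = skewC (sigma a) * skewX + skewC (delta a).
Proof.
have skewCM c q : skew_mul c%:P q = c *: q.
  by rewrite -[c%:P]mulr1 mul_polyC skew_mulZl skew_mul1l.
transitivity (skew_mul 'X a%:P : skewpoly delta); first by [].
transitivity (skew_mul (sigma a)%:P 'X + (delta a)%:P : {poly F}); last by [].
rewrite -['X]expr1 skew_mulXn /= /skew_Xmul !map_polyC skewCM expr1.
by rewrite mul_polyC.
Qed.

Lemma skewXnE n : skewX ^+ n = ('X^n : {poly F}).
Proof.
elim: n => [|n IHn]; first by rewrite !expr0.
rewrite exprS IHn; have := skew_mulXn 1 'X^n; rewrite expr1 /= skew_XmulXn.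
exact.
Qed.

Definition scoef (p : skewpoly delta) (i : nat) : F := (p : {poly F})`_i.

(* 0 at the zero polynomial *)
Definition sdeg (p : skewpoly delta) : nat := (size (p : {poly F})).-1.

Lemma skewpolyE (p : skewpoly delta) :
  p = \sum_(i < (sdeg p).+1) scoef p i *: skewX ^+ i.
Proof.
under eq_bigr do rewrite skewXnE.
rewrite -[LHS](@coefK _ (p : {poly F})) poly_def /scoef /sdeg.
case: (size _) (@coefK _ (p : {poly F})) => //=.
rewrite poly_def !big_ord0 big_ord1 => <-; rewrite coef0; symmetry.
exact: scale0r.
Qed.

Lemma size_skew_Xmul p : (size (skew_Xmul p) <= (size p).+1)%N.
Proof.
apply/leq_sizeP=> j lpj; rewrite coefD coefMX !coef_map_id0 ?raddf0 //.
rewrite [p`_j]nth_default 1?ltnW // raddf0 addr0.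
case: j lpj => //= j lpj.
by rewrite nth_default // raddf0.
Qed.

Lemma size_skew_mul p q m n :
  (size p <= m)%N -> (size q <= n.+1)%N -> (size (skew_mul p q) <= m + n)%N.
Proof.
move=> lepm leqn; apply: (leq_trans (size_sum _ _ _)).
apply/bigmax_leqP=> i _; apply: (leq_trans (size_scale_leq _ _)).
have: (size (iter i skew_Xmul q) <= i + n.+1)%N.
  elim: (i : nat) => //= k IHk; apply: (leq_trans (size_skew_Xmul _)).
  by rewrite addSn ltnS.
move/leq_trans; apply; rewrite addnS -addSn leq_add2r.
exact: leq_trans (ltn_ord i) lepm.
Qed.

Definition is_gcrd (f g d : skewpoly delta) : Prop :=
  scoef d (sdeg d) = 1 /\
  forall h : skewpoly delta,
    (exists u : skewpoly delta, h = u * d)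
    <-> (exists a b : skewpoly delta, h = a * f + b * g).

(* The monic generator d of Rf + Rg. The default value 0 is only taken when
   there is none; over a division ring, only when f = g = 0 (see gcrdP). *)
Definition gcrd (f g : skewpoly delta) : skewpoly delta :=
  xget 0 [set d : skewpoly delta | is_gcrd f g d]%classic.

End SkewPoly.

(* P_k, the polynomials of degree at most k *)
Notation skewP F k := {poly_(k.+1) F}.

Section Sylvester.
Variables (F : nzRingType) (sigma : {rmorphism F -> F}).
Variable delta : sderivation sigma.
Variables f g : skewpoly delta.
Let m := sdeg f.
Let n := sdeg g.

Definition sylv_comb (a b : skewpoly delta) : skewpoly delta := a * f + b * g.

Section Phi.
Hypotheses (m_gt0 : (0 < m)%N) (n_gt0 : (0 < n)%N).

Lemma sylv_comb_size (u : skewP F n.-1 * skewP F m.-1) :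
  sylv_comb (val u.1) (val u.2) \is a @poly_of_size F (n + m).-1.+1.
Proof.
have le0 (v : {poly F}) k : (size v).-1 = k -> (size v <= k.+1)%N.
  by move=> <-; exact: leqSpred.
have su1 : (size (val u.1) <= n)%N.
  by apply: leq_trans (size_npoly u.1) _; rewrite prednK.
have su2 : (size (val u.2) <= m)%N.
  by apply: leq_trans (size_npoly u.2) _; rewrite prednK.
rewrite qualifE /=; apply: (leq_trans (size_polyD _ _)).
have -> : (n + m).-1.+1 = (n + m)%N by rewrite prednK ?addn_gt0 ?n_gt0.
rewrite geq_max; apply/andP; split; last rewrite addnC.
  by apply: size_skew_mul; last exact: le0.
by apply: size_skew_mul; last exact: le0.
Qed.

Definition sylv_map (u : skewP F n.-1 * skewP F m.-1) : skewP F (n + m).-1 :=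
  NPoly (sylv_comb_size u).

Lemma sylv_map_linear : linear sylv_map.
Proof.
move=> c u v; apply: val_inj.
suff E (a1 a2 b1 b2 : skewpoly delta) :
    sylv_comb (c *: a1 + b1) (c *: a2 + b2)
      = c *: sylv_comb a1 a2 + sylv_comb b1 b2 by exact: E.
by rewrite /sylv_comb !mulrDl -!scalerAl scalerDr addrACA.
Qed.

HB.instance Definition _ := GRing.isLinear.Build F
  (skewP F n.-1 * skewP F m.-1)%type (skewP F (n + m).-1) _ sylv_map
  sylv_map_linear.
End Phi.

Definition sylv_mx : 'M[F]_(n + m) :=
  \matrix_(i, j)
    if (i < n)%N then scoef (skewX delta ^+ i * f) j
    else scoef (skewX delta ^+ (i - n) * g) j.
End Sylvester.

Section GcrdSpec.
Variables (F : unitRingType) (divF : division_ring F).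
Variables (sigma : {rmorphism F -> F}) (delta : sderivation sigma).
Implicit Types (p : {poly F}) (f g h d : skewpoly delta).

Let skew_Xmul := skew_Xmul delta.

Lemma coef_iter_skew_Xmul j k p : (size p <= k.+1)%N ->
  (size (iter j skew_Xmul p) <= (j + k).+1)%N /\
  (iter j skew_Xmul p)`_(j + k) = iter j sigma p`_k.
Proof.
move=> lep; elim: j => // j [IHs IHc]; split.
  exact: leq_trans (size_skew_Xmul delta _) _.
rewrite addSn /= coefD coefMX !coef_map_id0 ?raddf0 //=.
by rewrite IHc [_`_(_.+1)]nth_default // raddf0 addr0.
Qed.

Lemma skew_rdiv d h : d != 0 ->
  exists q r : skewpoly delta, h = q * d + r /\
    (size (r : {poly F}) < size (d : {poly F}))%N.
Proof.
move=> d0; have [k sd] : exists k, size (d : {poly F}) = k.+1.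
  by exists (size (d : {poly F})).-1; rewrite prednK // lt0n size_poly_eq0.
have dk : (d : {poly F})`_k \is a GRing.unit.
  by apply: divF; rewrite -[k]/(k.+1.-1) -sd -lead_coefE lead_coef_eq0.
have [n] := ubnP (size (h : {poly F})); elim: n h => // n IHn h; rewrite ltnS => len.
have [lth|leh] := ltnP (size (h : {poly F})) (size (d : {poly F})).
  by exists 0, h; rewrite mul0r add0r.
have sh : size (h : {poly F}) = (size (h : {poly F}) - k.+1 + k).+1.
  by rewrite -addnS subnK // -sd.
set j := (_ - _)%N in sh.
have [sX cX] := @coef_iter_skew_Xmul j k d (eq_leq sd).
have uj : iter j sigma (d : {poly F})`_k \is a GRing.unit.
  by elim: (j) => //= i IHi; exact: rmorph_unit.
pose c := (h : {poly F})`_(j + k) * (iter j sigma (d : {poly F})`_k)^-1.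
pose t : skewpoly delta := c *: skewX delta ^+ j.
have td : t * d = (c *: iter j skew_Xmul d : {poly F}).
  by rewrite /t -scalerAl skewXnE; congr (_ *: _); exact: skew_mulXn.
have [|q [r [hq sr]]] := IHn (h - t * d).
  apply: leq_trans len; rewrite sh ltnS td; apply/leq_sizeP => i.
  rewrite leq_eqVlt => /orP[/eqP <-|lti].
    by rewrite coefB coefZ cX /c -mulrA mulVr // mulr1 subrr.
  by rewrite coefB coefZ !nth_default ?mulr0 ?subrr // ?sh // (leq_trans sX).
exists (q + t), r; split=> //.
by rewrite mulrDl addrAC -hq subrK.
Qed.

Lemma gcrdP f g : (f != 0) || (g != 0) -> is_gcrd f g (gcrd f g).
Proof.
move=> fg0; suff : exists d, [set d | is_gcrd f g d]%classic d by move/xgetPex; exact.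
pose I h := exists a b, h = a * f + b * g.
have IB h1 h2 u : I h1 -> I h2 -> I (h1 - u * h2).
  move=> [a1 [b1 ->]] [a2 [b2 ->]]; exists (a1 - u * a2), (b1 - u * b2).
  by rewrite !mulrBl mulrDr !mulrA opprD addrACA.
have I0 : I 0 by exists 0, 0; rewrite !mul0r addr0.
pose P n := `[<exists d, [/\ I d, d != 0 & size (d : {poly F}) = n]>].
have exP : exists n, P n.
  case/orP: fg0 => n0.
    by exists (size (f : {poly F})); apply/asboolP; exists f; split => //;
      exists 1, 0; rewrite mul1r mul0r addr0.
  by exists (size (g : {poly F})); apply/asboolP; exists g; split => //;
    exists 0, 1; rewrite mul1r mul0r add0r.
case: (ex_minnP exP) => n /asboolP[d [Id d0 sd]] dmin.
have ud : lead_coef (d : {poly F}) \is a GRing.unit.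
  by apply: divF; rewrite lead_coef_eq0.
pose c := (lead_coef (d : {poly F}))^-1.
pose e : skewpoly delta := c *: d.
have uc : c \is a GRing.unit by rewrite unitrV.
have de : d = c^-1 *: e by rewrite /e scalerA mulVr // scale1r.
have se : size (e : {poly F}) = size (d : {poly F}).
  apply/eqP; rewrite eqn_leq size_scale_leq /=.
  by rewrite {1}de; exact: size_scale_leq.
exists e; split.
  by rewrite /scoef /sdeg se coefZ mulVr.
move=> h; split=> [[u ->]|Ih].
  have := IB 0 d (- (u * (c *: 1))) I0 Id.
  by rewrite sub0r mulNr opprK -mulrA -scalerAl mul1r.
have [q [r [hq sr]]] := skew_rdiv h d0.
exists (q * (c^-1 *: 1)); rewrite -mulrA -scalerAl mul1r -de hq.
have [->|r0] := eqVneq r 0; first by rewrite addr0.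
suff /dmin : P (size (r : {poly F})) by rewrite leqNgt -sd sr.
apply/asboolP; exists r; split=> //.
have -> : r = h - q * d by rewrite hq addrC addKr.
exact: IB.
Qed.

End GcrdSpec.

(* Main.v *)
(* Let d = gcrd(f, g). The image of (a, b) |-> a f + b g on deg a < n, deg b < m
   is the set of left multiples of d of degree < m + n: an element a f + b g of
   R f + R g = R d with deg a arbitrary is brought into range by dividing a by u,
   where u f = v g is a common left multiple with deg u <= n, which exists by
   counting dimensions. That set has dimension m + n - deg d, so by rank-nullity
   the kernel has dimension deg d. In coordinates the map is x |-> x A, and the
   two ranks of A agree because both are the least r for which A = B C with B
   having r columns. *)
From HB Require Import structures.
Require Import Defs.
From mathcomp Require Import all_boot all_order all_algebra.
From mathcomp Require Import boolp classical_sets.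
Import GRing.Theory.
Local Open Scope ring_scope.

(** * Dimension theory of left modules over a division ring *)

Section LeftLinearAlgebra.
Variables (R : unitRingType) (divR : division_ring R).

Lemma lspan_mem {V : lmodType R} {n} (e : 'I_n -> V) i : lspan e (e i).
Proof.
exists (fun j => (j == i)%:R); rewrite (bigD1 i) //= eqxx scale1r big1 ?addr0 //.
by move=> j /negbTE ->; rewrite scale0r.
Qed.

Definition lsubspace {V : lmodType R} (U : set V) : Prop :=
  U 0 /\ forall (c : R) u v, U u -> U v -> U (c *: u + v).

Lemma lsubspace_sum {V : lmodType R} {U : set V} {n} (c : 'I_n -> R)
    (e : 'I_n -> V) :
  lsubspace U -> (forall i, U (e i)) -> U (\sum_i c i *: e i).
Proof.
move=> [U0 UP] Ue; elim/big_rec: _ => // i v _ Uv.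
exact: UP.
Qed.

Lemma lsubspace_lspan {V : lmodType R} {n} (e : 'I_n -> V) : lsubspace (lspan e).
Proof.
split=> [|c u v [x ->] [y ->]].
  by exists (fun=> 0); rewrite big1 // => i _; rewrite scale0r.
exists (fun i => c * x i + y i).
rewrite scaler_sumr -big_split; apply: eq_bigr => i _ /=.
by rewrite scalerDl scalerA.
Qed.

Lemma lspan_sub {V : lmodType R} {m n} (e : 'I_m -> V) (b : 'I_n -> V) :
  (forall i, lspan b (e i)) -> (lspan e `<=` lspan b)%classic.
Proof.
by move=> eb _ [c ->]; apply: lsubspace_sum eb; apply: lsubspace_lspan.
Qed.

(** If [n < m], the coordinate vectors of the [e i] over [b] are left dependent by [division_dep],
    and the dependency carries over to [e]. *)
Lemma lfree_leq {V : lmodType R} {m n} (e : 'I_m -> V) (b : 'I_n -> V) :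
  lfree e -> (forall i, lspan b (e i)) -> (m <= n)%N.
Proof.
move=> efree eb; rewrite leqNgt; apply/negP => ltnm.
have [C eC] := choice eb.
have [x [i /eqP xi] xC] := division_dep divR C ltnm.
apply: xi; apply: efree.
under eq_bigr do rewrite eC scaler_sumr.
rewrite exchange_big big1 //= => j _.
under eq_bigr do rewrite scalerA.
by rewrite -scaler_suml xC scale0r.
Qed.

(** A relation with a nonzero coefficient at [u] could be solved for [u], because that coefficient
    is invertible. The new vector sits at index 0. *)
Lemma lfree_extend {V : lmodType R} {n} (e : 'I_n -> V) (u : V) :
  lfree e -> ~ lspan e u -> lfree (fun i => oapp e u (unlift ord0 i)).
Proof.
move=> efree eu c; rewrite big_ord_recl /= unlift_none /=.
under eq_bigr do rewrite liftK /=.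
have [c0|c0] := eqVneq (c ord0) 0.
  rewrite c0 scale0r add0r => /efree e0 i.
  by case: (unliftP ord0 i) => [j ->|->].
move=> /eqP; rewrite addr_eq0 => /eqP cu; case: eu.
exists (fun i => - ((c ord0)^-1 * c (lift ord0 i))).
rewrite -[LHS]scale1r -(mulVr (divR _ c0)) -scalerA cu scalerN scaler_sumr -sumrN.
by apply: eq_bigr => i _; rewrite scaleNr scalerA.
Qed.

(** Free families inside [U] have length at most [n]; one of maximal length cannot be extended, so
    it spans [U]. *)
Lemma is_ldim_sub {V : lmodType R} {U : set V} {n} (b : 'I_n -> V) :
  lsubspace U -> (U `<=` lspan b)%classic -> exists k, is_ldim U k.
Proof.
move=> sU Ub.
pose P k := `[<exists e : 'I_k -> V, lfree e /\ forall i, U (e i)>].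
have exP : exists k, P k.
  exists 0%N; apply/asboolP; exists (fun=> 0).
  by split=> [c _ [] | []].
have ubP k : P k -> (k <= n)%N.
  by move=> /asboolP[e [efree eU]]; apply: lfree_leq efree _ => i; apply: Ub.
case: (ex_maxnP exP ubP) => k /asboolP[e [efree eU]] kmax.
exists k, e; split=> //; apply/seteqP; split=> [_ [c ->]|u Uu].
  exact: lsubspace_sum.
apply: contrapT => /(lfree_extend _ _ efree) e'free.
suff /kmax : P k.+1 by rewrite ltnn.
apply/asboolP; exists (fun i => oapp e u (unlift ord0 i)); split=> // i.
by case: (unlift _ _) => /=.
Qed.

Lemma lsubspace_lkernel {W V : lmodType R} (h : {linear W -> V}) :
  lsubspace (lkernel h).
Proof.
split=> [|c u v hu hv]; first exact: linear0.
by rewrite /lkernel /= linearP hu hv scaler0 addr0.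
Qed.

Lemma lsubspace_range {W V : lmodType R} (h : {linear W -> V}) :
  lsubspace (range h).
Proof.
split=> [|c _ _ [u _ <-] [v _ <-]]; first by exists 0; rewrite ?linear0.
by exists (c *: u + v); rewrite ?linearP.
Qed.

(** A basis of the kernel followed by preimages of a basis of the image is a basis of [W];
    uniqueness of the dimension then gives the sum. *)
Lemma rank_nullity {W V : lmodType R} (h : {linear W -> V}) {N} :
  is_ldim [set: W]%classic N ->
  exists k r, [/\ is_ldim (lkernel h) k, is_ldim (range h) r & (k + r = N)%N].
Proof.
move=> dimW; have [b [_ bT]] := dimW.
have [k kerk] : exists k, is_ldim (lkernel h) k.
  by apply: (is_ldim_sub b (lsubspace_lkernel h)); rewrite bT.
have [r imr] : exists r, is_ldim (range h) r.
  apply: (is_ldim_sub (h \o b) (lsubspace_range h)) => _ [w _ <-].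
  have [c ->] : lspan b w by rewrite bT.
  by exists c; rewrite linear_sum; apply: eq_bigr => i _; rewrite linearZ.
exists k, r; split=> //.
have [a [afree aE]] := kerk; have [y [yfree yE]] := imr.
have ha i : h (a i) = 0 by have := lspan_mem a i; rewrite aE.
have /choice [w hw] : forall j, exists w, h w = y j.
  by move=> j; have := lspan_mem y j; rewrite yE => -[w _ <-]; exists w.
pose e (i : 'I_(k + r)) := match split i with inl j => a j | inr j => w j end.
have el i : e (lshift r i) = a i by rewrite /e (unsplitK (inl i)).
have er j : e (rshift k j) = w j by rewrite /e (unsplitK (inr j)).
have sumE c : \sum_i c i *: e i =
    \sum_i c (lshift r i) *: a i + \sum_j c (rshift k j) *: w j.
  rewrite big_split_ord /=; congr (_ + _); apply: eq_bigr => i _.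
    by rewrite el.
  by rewrite er.
have hsum (c : 'I_r -> R) : h (\sum_j c j *: w j) = \sum_j c j *: y j.
  by rewrite linear_sum; apply: eq_bigr => i _; rewrite linearZ /= hw.
rewrite -(ldimE divR dimW); symmetry; apply: (ldimE divR); exists e; split.
  move=> c; rewrite sumE => s0.
  (* Applying [h] removes the kernel part and leaves a relation between the [y j]. *)
  have c2 : forall j, c (rshift k j) = 0.
    apply: yfree; rewrite -hsum; move/(congr1 h): s0.
    rewrite linear0 linearD linear_sum big1 ?add0r // => i _.
    by rewrite linearZ /= ha scaler0.
  have c1 : forall i, c (lshift r i) = 0.
    apply: afree; rewrite -[RHS]s0 [X in _ + X]big1 ?addr0 // => j _.
    by rewrite c2 scale0r.
  by move=> i; rewrite -(splitK i); case: (split i) => /=.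
apply/seteqP; split=> // v _.
have [c hv] : lspan y (h v) by rewrite yE; exists v.
(* Once the chosen preimage of [h v] is subtracted, a vector of the kernel remains. *)
have [c' v'] : lspan a (v - \sum_j c j *: w j).
  by rewrite aE /lkernel /= linearB /= hsum hv subrr.
exists (fun i => match split i with inl j => c' j | inr j => c j end).
rewrite sumE.
under eq_bigr do rewrite (unsplitK (inl _)).
under [X in _ + X]eq_bigr do rewrite (unsplitK (inr _)).
by rewrite -v' subrK.
Qed.

Lemma is_ldim_inj {W V : lmodType R} (h : {linear W -> V}) {U : set W} {n} :
  injective h -> is_ldim U n -> is_ldim (h @` U)%classic n.
Proof.
move=> hinj [e [efree eU]]; exists (h \o e).
have hsum c : \sum_i c i *: h (e i) = h (\sum_i c i *: e i).
  by rewrite linear_sum; apply: eq_bigr => i _; rewrite linearZ.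
split=> [c /=|]; first by rewrite hsum -(linear0 h) => /hinj /efree.
rewrite -eU; apply/seteqP; split=> [_ [c ->]|_ [_ [c ->] <-]].
  by exists (\sum_i c i *: e i); [exists c|rewrite hsum].
by exists c; rewrite hsum.
Qed.

Lemma is_ldim_rV n : is_ldim [set: 'rV[R]_n]%classic n.
Proof.
exists (fun i => 'e_i); split=> [c c0 i|].
  have /rowP/(_ i) := c0; rewrite summxE (bigD1 i) //= big1 => [|j ji].
    by rewrite addr0 !mxE !eqxx mulr1.
  by rewrite !mxE eq_sym (negbTE ji) andbF mulr0.
apply/seteqP; split=> // v _; exists (v 0).
exact: row_sum_delta.
Qed.

Lemma lspan_is_ldim {V : lmodType R} {n} (e : 'I_n -> V) :
  is_ldim (lspan e) (ldim (lspan e)).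
Proof.
have [k dk] := is_ldim_sub e (lsubspace_lspan e) (fun v H => H).
by rewrite (ldimE divR dk).
Qed.

Lemma ldim_lspan_leq {V : lmodType R} {m n} (e : 'I_m -> V) (b : 'I_n -> V) :
  (forall i, lspan b (e i)) -> (ldim (lspan e) <= n)%N.
Proof.
move=> eb; have [a [afree aE]] := lspan_is_ldim e.
apply: (lfree_leq a b afree) => i; apply: (lspan_sub e b eb).
by rewrite -aE; exact: lspan_mem.
Qed.

(** Applied to the rows or the columns of a matrix, this is a factorization whose inner size is the
    rank. *)
Lemma ldim_lspan_coord {V : lmodType R} {m} (e : 'I_m -> V) :
  exists (C : 'I_m -> 'I_(ldim (lspan e)) -> R) (b : 'I_(ldim (lspan e)) -> V),
    forall i, e i = \sum_j C i j *: b j.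
Proof.
have [b [_ bE]] := lspan_is_ldim e.
have /choice [C eC] : forall i, lspan b (e i) by rewrite bE; exact: lspan_mem.
by exists C, b.
Qed.

End LeftLinearAlgebra.

(** * Row rank, column rank and nullity of a matrix *)

Lemma lr_rk_rc_rk {F : unitRingType} (divF : division_ring F) {m n}
  (A : 'M[F]_(m, n)) : lr_rk A = rc_rk A.
Proof.
have divFc : division_ring F^c by exact: divF.
apply/eqP; rewrite eqn_leq; apply/andP; split.
  (* Products in [F^c] are reversed, so the column coordinates read [A i j = \sum_l b l i 0 * C j l]
     in [F]: each row is a left combination of [rc_rk A] fixed rows. *)
  have [C [b eC]] := ldim_lspan_coord _ divFc
    (fun j => col j (A : 'M[F^c]_(m, n))).
  apply: (ldim_lspan_leq _ divF _ (fun j => \row_i C i j)) => i.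
  exists (fun j => b j i 0); apply/rowP => j.
  have /colP/(_ i) := eC j; rewrite !mxE !summxE => ->.
  by apply: eq_bigr => l _; rewrite !mxE.
(* Symmetrically, [A i j = \sum_l C i l * b l 0 j] makes each column a right combination of
   [lr_rk A] fixed columns. *)
have [C [b eC]] := ldim_lspan_coord _ divF (fun i => row i A).
apply: (@ldim_lspan_leq F^c divFc _ _ _ _
  (fun j => \col_i (C i j : F^c))) => j.
exists (fun l => b l 0 j); apply/colP => i.
have /rowP/(_ j) := eC i; rewrite !mxE !summxE => ->.
by apply: eq_bigr => l _; rewrite !mxE.
Qed.

(** Rank-nullity for [x |-> x A], whose image is the row space. *)
Lemma lr_rk_nullity {F : unitRingType} (divF : division_ring F) {m n}
  (A : 'M[F]_(m, n)) :
  (ldim (lkernel (mulmxr A : {linear 'rV_m -> 'rV_n})) + lr_rk A = m)%N.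
Proof.
have [k [r [kerk imr krm]]] :=
  rank_nullity _ divF (mulmxr A : {linear 'rV_m -> 'rV_n}) (is_ldim_rV F m).
rewrite (ldimE divF kerk) -[RHS]krm /lr_rk; congr (_ + _)%N; apply: (ldimE divF).
suff -> : lspan (fun i => row i A) = range (mulmxr A : 'rV_m -> 'rV_n) by [].
apply/seteqP; split=> [_ [c ->]|_ [x _ <-]].
  exists (\row_i c i) => //=; rewrite mulmx_sum_row.
  by apply: eq_bigr => i _; rewrite mxE.
by exists (x 0); rewrite /= mulmx_sum_row.
Qed.

(** * Degrees of products and common left multiples of skew polynomials *)

Section SkewPolyDivision.
Variables (F : unitRingType) (divF : division_ring F).
Variables (sigma : {rmorphism F -> F}) (delta : sderivation sigma).
Implicit Types f g h p q : skewpoly delta.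

Local Notation ssize p := (size (p%R : {poly F})).

(** With [j] and [k] the degrees, the coefficient of the product at [j + k] is [p_j * sigma^j(q_k)],
    a unit since [sigma] preserves units. *)
Lemma size_skewM p q : p != 0 -> q != 0 ->
  ssize (p * q) = (ssize p + ssize q).-1.
Proof.
move=> p0 q0.
have [j sp] : exists j, ssize p = j.+1.
  by exists (ssize p).-1; rewrite prednK // lt0n size_poly_eq0.
have [k sq] : exists k, ssize q = k.+1.
  by exists (ssize q).-1; rewrite prednK // lt0n size_poly_eq0.
have lead_unit r i : r != 0 -> ssize r = i.+1 -> (r : {poly F})`_i \is a GRing.unit.
  move=> r0 sr; apply: divF; rewrite -[i]/(i.+1.-1) -sr -lead_coefE.
  by rewrite lead_coef_eq0.
rewrite sp sq addSn /= addnS; apply/eqP; rewrite eqn_leq; apply/andP; split.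
  rewrite -addSn; apply: (@size_skew_mul _ _ delta p q); first by rewrite sp.
  by rewrite sq.
rewrite ltnNge; apply/negP => /leq_sizeP /(_ _ (leqnn _)).
have -> : p * q = \sum_(i < j.+1) (p : {poly F})`_i *: iter i (skew_Xmul delta) q.
  by apply: skew_mulEw; rewrite sp.
(* Only the last term [i = j] reaches degree [j + k]. *)
rewrite coef_sum big_ord_recr /= big1 => [|i _].
  have [_ cj] := coef_iter_skew_Xmul delta j (eq_leq sq).
  rewrite add0r coefZ cj => pq0.
  have : (p : {poly F})`_j * iter j sigma (q : {poly F})`_k \is a GRing.unit.
    rewrite unitrMr ?lead_unit //.
    by elim: (j) => [|i IHi] /=; [exact: lead_unit | exact: rmorph_unit].
  by rewrite pq0 unitr0.
have [si _] := coef_iter_skew_Xmul delta i (eq_leq sq).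
rewrite coefZ [X in _ * X]nth_default ?mulr0 // (leq_trans si) //.
by rewrite -addSn leq_add2r.
Qed.

Lemma skewM_eq0 p q : p * q = 0 -> p = 0 \/ q = 0.
Proof.
have [->|p0] := eqVneq p 0; first by left.
have [->|q0] := eqVneq q 0; first by right.
move/(congr1 (fun r : skewpoly delta => ssize r)); rewrite size_skewM //.
have := p0; have := q0; rewrite -!size_poly_eq0 size_poly0.
case: (ssize q) => // k _; case: (ssize p) => // j _.
by rewrite addSn addnS.
Qed.

Lemma size_skewM_leq p q j k : (ssize p <= j)%N -> (ssize q <= k.+1)%N ->
  (ssize (p * q) <= j + k)%N.
Proof. exact: size_skew_mul. Qed.

Lemma size_skewM_geq p q j k : (k < ssize q)%N -> (ssize (p * q) <= j + k)%N ->
  (ssize p <= j)%N.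
Proof.
move=> kq; have [->|p0] := eqVneq p 0; first by rewrite size_poly0.
have q0 : q != 0 by rewrite -size_poly_gt0 (leq_ltn_trans _ kq).
rewrite size_skewM //; case: (ssize q) kq => // l; rewrite ltnS addnS /= => kl spq.
by rewrite -(leq_add2r k); apply: leq_trans spq; rewrite leq_add2l.
Qed.

Lemma skewM_rVpoly k (y : 'rV[F]_k) p :
  (rVpoly y : skewpoly delta) * p = \sum_i y 0 i *: (skewX delta ^+ i * p).
Proof.
transitivity (\sum_(i < k) (rVpoly y)`_i *: iter i (skew_Xmul delta) p).
  exact/skew_mulEw/size_poly.
apply: eq_bigr => i _; rewrite coef_rVpoly_ord skewXnE; congr (_ *: _).
by rewrite -skew_mulXn.
Qed.

(** * Right multiplication and combinations on coefficient vectors *)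

Definition rmul_rV p k (y : 'rV[F]_k) : skewpoly delta :=
  (rVpoly y : skewpoly delta) * p.

Lemma rmul_rV_linear p k : linear (@rmul_rV p k).
Proof. by move=> c x y; rewrite /rmul_rV linearP mulrDl scalerAl. Qed.

HB.instance Definition _ p k := GRing.isLinear.Build F 'rV[F]_k
  (skewpoly delta) _ (@rmul_rV p k) (rmul_rV_linear p k).

Lemma rmul_rV_inj p k : p != 0 -> injective (@rmul_rV p k).
Proof.
move=> p0 x y /eqP; rewrite -subr_eq0 -linearB /= => /eqP /skewM_eq0 [|pe0].
  by rewrite linearB => /eqP; rewrite subr_eq0 => /eqP /(can_inj rVpolyK).
by rewrite pe0 eqxx in p0.
Qed.

(** The map [varphi] in coordinates, with free block lengths: [left_syzygy] takes both one larger
    than the Sylvester case does. *)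
Definition comb_rV f g a b (x : 'rV[F]_(a + b)) : skewpoly delta :=
  rmul_rV f a (lsubmx x) + rmul_rV g b (rsubmx x).

Lemma comb_rV_linear f g a b : linear (@comb_rV f g a b).
Proof. by move=> c x y; rewrite /comb_rV !linearP scalerDr addrACA. Qed.

HB.instance Definition _ f g a b := GRing.isLinear.Build F 'rV[F]_(a + b)
  (skewpoly delta) _ (@comb_rV f g a b) (comb_rV_linear f g a b).

Lemma size_comb_rV f g a b N (x : 'rV[F]_(a + b)) :
  (a + (ssize f).-1 <= N)%N -> (b + (ssize g).-1 <= N)%N ->
  (ssize (comb_rV f g a b x) <= N)%N.
Proof.
move=> leaN lebN; apply: leq_trans (size_polyD _ _) _; rewrite geq_max.
by apply/andP; split; [apply: leq_trans leaN|apply: leq_trans lebN];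
  apply: size_skewM_leq; rewrite ?size_poly ?leqSpred.
Qed.

(** Counting: the coefficients of [u] and [v] give [n + m + 2] unknowns, while the combination has
    only [n + m + 1] coefficients to cancel. *)
Lemma left_syzygy f g : f != 0 -> g != 0 -> exists u v : skewpoly delta,
  [/\ u != 0, (ssize u <= ssize g)%N & u * f = v * g].
Proof.
move=> f0 g0; have [m sf] : exists m, ssize f = m.+1.
  by exists (ssize f).-1; rewrite prednK // lt0n size_poly_eq0.
have [n sg] : exists n, ssize g = n.+1.
  by exists (ssize g).-1; rewrite prednK // lt0n size_poly_eq0.
pose psi := comb_rV f g n.+1 m.+1.
have [x [i xi] xC] := division_dep divF (n := (n + m).+1)
  (fun (i : 'I_(n.+1 + m.+1)) (j : 'I_(n + m).+1) =>
     (psi 'e_i : {poly F})`_j) ltac:(by rewrite addSn addnS).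
pose y := \row_i x i.
have y0 : y != 0 by apply: contraNneq xi => /rowP/(_ i); rewrite !mxE => ->.
have psi0 : psi y = 0.
  apply/polyP => j; rewrite [RHS]coef0.
  have [ltj|lej] := ltnP j (n + m).+1; last first.
    apply: nth_default; apply: leq_trans lej; apply: size_comb_rV.
      by rewrite sf.
    by rewrite sg addSn addnC.
  rewrite -[RHS](xC (Ordinal ltj)) [y]row_sum_delta [psi _]linear_sum /= coef_sum.
  by apply: eq_bigr => l _; rewrite linearZ /= coefZ mxE.
have uv : (rVpoly (lsubmx y) : skewpoly delta) * f =
    (rVpoly (- rsubmx y) : skewpoly delta) * g.
  by apply/eqP; rewrite linearN mulNr -addr_eq0; apply/eqP.
exists (rVpoly (lsubmx y)), (rVpoly (- rsubmx y)); split=> //; last first.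
  by rewrite sg size_poly.
(* If [u = 0] then [v * g = 0], so [v = 0] as well and the whole solution [y] vanishes. *)
apply: contraNneq y0 => u0; move: uv; rewrite u0 mul0r => /esym /skewM_eq0.
case=> [v0|/eqP]; last by rewrite (negbTE g0).
have rV0 k (z : 'rV[F]_k) : rVpoly z = 0 -> z = 0.
  by move=> z0; rewrite -[z]rVpolyK z0 linear0.
rewrite -[y]hsubmxK (rV0 _ _ u0) -[rsubmx y]opprK (rV0 _ _ v0) oppr0.
by rewrite row_mx0.
Qed.

(** * Image and kernel of the combination map, through the gcrd *)

Section Gcrd.
Variables f g : skewpoly delta.
Hypotheses (fpos : (0 < sdeg f)%N) (gpos : (0 < sdeg g)%N).
Let m := sdeg f.
Let n := sdeg g.
Let d := gcrd f g.

Let sf : ssize f = m.+1.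
Proof. by have := fpos; rewrite /m /sdeg; case: (size _). Qed.

Let sg : ssize g = n.+1.
Proof. by have := gpos; rewrite /n /sdeg; case: (size _). Qed.

Let f0 : f != 0. Proof. by rewrite -size_poly_eq0 sf. Qed.
Let g0 : g != 0. Proof. by rewrite -size_poly_eq0 sg. Qed.

Let dP : is_gcrd f g d. Proof. by apply: gcrdP; rewrite ?f0. Qed.

Let d0 : d != 0.
Proof.
have [dmon _] := dP; apply/eqP => d_eq0; move: dmon.
by rewrite d_eq0 /scoef coef0 => /esym/eqP; rewrite oner_eq0.
Qed.

Let sd : ssize d = (sdeg d).+1.
Proof. by rewrite /sdeg prednK // lt0n size_poly_eq0. Qed.

(** [f] is a nonzero left multiple of [d]. The bound keeps the truncated subtraction
    [n + m - sdeg d] exact. *)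
Lemma sdeg_gcrd_leq : (sdeg d <= n + m)%N.
Proof.
have [_ /(_ f) [_ ]] := dP.
case; first by exists 1, 0; rewrite mul1r mul0r addr0.
move=> u fu; have u0 : u != 0.
  by apply: contraNneq f0 => u0; rewrite fu u0 mul0r.
apply: leq_trans (leq_addl _ _); rewrite -ltnS -sf fu size_skewM // sd addnS /=.
by rewrite -addn1 addnC leq_add2r lt0n size_poly_eq0.
Qed.

Lemma range_comb_rV :
  range (comb_rV f g n m) = range (rmul_rV d (n + m - sdeg d)).
Proof.
have [u [v [u0 su uv]]] := left_syzygy _ _ f0 g0.
have [_ dI] := dP.
apply/seteqP; split=> [_ [x _ <-]|_ [y _ <-]].
  have [|w xw] := (dI (comb_rV f g n m x)).2.
    by exists (rVpoly (lsubmx x)), (rVpoly (rsubmx x)).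
  exists (poly_rV (w : {poly F})) => //; rewrite xw /rmul_rV poly_rV_K //.
  apply: (@size_skewM_geq w d _ (sdeg d)); first by rewrite sd.
  rewrite subnK ?sdeg_gcrd_leq // -xw.
  by apply: size_comb_rV; rewrite ?sf ?sg // addnC.
have [|a [b yab]] := (dI (rmul_rV d _ y)).1; first by exists (rVpoly y).
(* Writing [a = q u + r] and using [u f = v g] moves [q u f] into the coefficient of [g], leaving
   [r] of degree below [n]. *)
have [q [r [aq sr]]] := skew_rdiv divF a u0.
have ybr : rmul_rV d _ y = r * f + (b + q * v) * g.
  by rewrite yab aq !mulrDl -!mulrA uv (addrC (q * _)) -addrA (addrC (q * _)).
have srn : (ssize r <= n)%N by rewrite -ltnS -sg (leq_trans sr).
(* The other coefficient is bounded through its product with [g], which is a difference of two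
   polynomials of size at most [n + m]. *)
have sbm : (ssize (b + q * v) <= m)%N.
  apply: (@size_skewM_geq _ g _ n); first by rewrite sg.
  have -> : (b + q * v) * g = rmul_rV d _ y - r * f by rewrite ybr [RHS]addrC addKr.
  apply: leq_trans (size_polyD _ _) _; rewrite size_polyN geq_max.
  apply/andP; split; last by rewrite addnC; apply: size_skewM_leq; rewrite ?sf.
  rewrite [leqRHS]addnC -[leqRHS](subnK sdeg_gcrd_leq).
  by apply: size_skewM_leq; rewrite ?size_poly ?sd.
exists (row_mx (poly_rV (r : {poly F})) (poly_rV (b + q * v : {poly F}))) => //.
by rewrite /comb_rV row_mxKl row_mxKr /rmul_rV !poly_rV_K.
Qed.

(** The rows of the Sylvester matrix are the coefficient vectors of the [x^i f] and [x^i g], which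
    [skewM_rVpoly] combines with the entries of the vector. *)
Lemma poly_rV_comb_rV (x : 'rV[F]_(n + m)) :
  poly_rV (comb_rV f g n m x : {poly F}) = x *m sylv_mx f g.
Proof.
apply/rowP => j; rewrite !mxE big_split_ord /comb_rV /rmul_rV !skewM_rVpoly.
rewrite coefD !coef_sum; congr (_ + _); apply: eq_bigr => i _.
  by rewrite coefZ !mxE /= ltn_ord.
by rewrite coefZ !mxE /= ltnNge leq_addr /= addKn.
Qed.

Lemma lkernel_comb_rV :
  lkernel (comb_rV f g n m) =
  lkernel (mulmxr (sylv_mx f g) : {linear 'rV_(n + m) -> 'rV_(n + m)}).
Proof.
apply/seteqP; split=> x; rewrite /lkernel /= -poly_rV_comb_rV => x0.
  by rewrite x0; exact: linear0.
(* The combination has size at most [n + m], so passing to its coefficient vector loses nothing. *)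
rewrite -[LHS](@poly_rV_K _ (n + m)) ?x0 ?linear0 //.
by apply: size_comb_rV; rewrite ?sf ?sg // addnC.
Qed.

Lemma is_ldim_lkernel_comb_rV : is_ldim (lkernel (comb_rV f g n m)) (sdeg d).
Proof.
have [k [r [kerk imr krN]]] :=
  rank_nullity _ divF (comb_rV f g n m) (is_ldim_rV F (n + m)).
suff <- : k = sdeg d by [].
(* Right multiplication by [d] is injective, so the image has dimension [n + m - sdeg d]. *)
have := is_ldim_inj _ (rmul_rV d (n + m - sdeg d)) (rmul_rV_inj d _ d0)
  (is_ldim_rV F _).
rewrite -range_comb_rV => /(ldimE divF); rewrite (ldimE divF imr) => r_eq.
by rewrite -(addnK r k) krN r_eq subKn // sdeg_gcrd_leq.
Qed.

(** * Transfer from row vectors to pairs of bounded polynomials *)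

Definition row_npolys (x : 'rV[F]_(n + m)) : skewP F n.-1 * skewP F m.-1 :=
  (npolyp n.-1.+1 (rVpoly (lsubmx x)), npolyp m.-1.+1 (rVpoly (rsubmx x))).

(** Positivity of [k] turns the bound [k.-1.+1] into [k], so nothing is truncated. *)
Let val_npolyp k (y : 'rV[F]_k) :
  (0 < k)%N -> val (npolyp k.-1.+1 (rVpoly y)) = rVpoly y.
Proof. by move=> k0; rewrite /= npolypK // prednK // size_poly. Qed.

Lemma row_npolys_linear : linear row_npolys.
Proof.
move=> c x y; rewrite /row_npolys !linearP.
congr (_, _); apply/npolyP => i; rewrite coefD coefZ !coef_npolyp coefD coefZ;
  by case: ifP; rewrite // mulr0 addr0.
Qed.

HB.instance Definition _ := GRing.isLinear.Build F 'rV[F]_(n + m)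
  (skewP F n.-1 * skewP F m.-1)%type _ row_npolys row_npolys_linear.

Lemma row_npolys_inj : injective row_npolys.
Proof.
move=> x y [/(congr1 val)]; rewrite !val_npolyp // => /(can_inj rVpolyK) xl.
move/(congr1 val); rewrite !val_npolyp // => /(can_inj rVpolyK) xr.
by rewrite -[x]hsubmxK xl xr hsubmxK.
Qed.

Lemma row_npolys_surj u : exists x, row_npolys x = u.
Proof.
case: u => a b; exists (row_mx (poly_rV (val a)) (poly_rV (val b))).
rewrite /row_npolys row_mxKl row_mxKr.
congr (_, _); apply: val_inj; rewrite val_npolyp // poly_rV_K //.
  by rewrite -[leqRHS](prednK gpos); exact: size_npoly.
by rewrite -[leqRHS](prednK fpos); exact: size_npoly.
Qed.

Lemma val_sylv_map_row_npolys x :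
  val (sylv_map fpos gpos (row_npolys x)) = comb_rV f g n m x.
Proof. by rewrite /= /sylv_comb !val_npolyp. Qed.

Lemma lkernel_sylv_map :
  lkernel (sylv_map fpos gpos : {linear _ -> _}) =
  (row_npolys @` lkernel (comb_rV f g n m))%classic.
Proof.
apply/seteqP; split=> [u|_ [x x0 <-]].
  have [x <-] := row_npolys_surj u; rewrite /lkernel /= => /(congr1 val).
  by rewrite val_sylv_map_row_npolys => x0; exists x.
by apply: val_inj; rewrite val_sylv_map_row_npolys.
Qed.

End Gcrd.
End SkewPolyDivision.
Theorem theorem3p8 (F : unitRingType) (divF : division_ring F)
    (sigma : {rmorphism F -> F}) (delta : sderivation sigma)
    (f g : skewpoly delta)
    (fpos : (0 < sdeg f)%N) (gpos : (0 < sdeg g)%N) :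
  let m := sdeg f in
  let n := sdeg g in
  let A : 'M[F]_(n + m) := sylv_mx f g in
  let varphi :
      {linear (skewP F n.-1 * skewP F m.-1)%type -> skewP F (n + m).-1} :=
    sylv_map fpos gpos in
  let phi : {linear 'rV[F]_(n + m) -> 'rV[F]_(n + m)} := mulmxr A in
  [/\ sdeg (gcrd f g) = ldim (lkernel varphi),
      ldim (lkernel varphi) = ldim (lkernel phi),
      (ldim (lkernel phi))%:Z = (n + m)%:Z - (lr_rk A)%:Z
    & (n + m)%:Z - (lr_rk A)%:Z = (n + m)%:Z - (rc_rk A)%:Z].
Proof.
move=> m n A varphi phi.
have kphi : is_ldim (lkernel phi) (sdeg (gcrd f g)).
  by rewrite /phi -lkernel_comb_rV //; exact: is_ldim_lkernel_comb_rV.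
(* The kernel of [varphi] is the image of the kernel in coordinates under the injective linear map
   [row_npolys]. *)
have kvarphi : is_ldim (lkernel varphi) (sdeg (gcrd f g)).
  rewrite /varphi lkernel_sylv_map; apply: is_ldim_inj.
    exact: row_npolys_inj.
  exact: is_ldim_lkernel_comb_rV.
split.
- by rewrite (ldimE divF kvarphi).
- by rewrite (ldimE divF kvarphi) (ldimE divF kphi).
- by have /(congr1 Posz) <- := lr_rk_nullity divF A; rewrite PoszD addrK.
- by rewrite (lr_rk_rc_rk divF).
Qed.
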